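(* Let $S$ be the circumscribed sphere of a tetrahedron and let $T$ be one of its eight tangent spheres. Keep $S$ and $T$ fixed and let the tetrahedron move (''rotate'') so that at all times its vertices lie on $S$ and the planes of its faces are tangent to $T$. Then there is a fixed sphere, concentric with $S$, to which all four Grace spheres of the moving tetrahedron that touch $T$ are tangent at all times.
   Context: All objects are in Euclidean space $\mathbb{R}^3$. A tangent sphere of a tetrahedron is a sphere tangent to the four planes containing its faces; a tetrahedron of general form has eight of them: the inscribed sphere, three doubly-exscribed spheres (first group), and four exscribed spheres (second group). Any two tangent spheres from different groups are homothetic with respect to one of the vertices of the tetrahedron, and (Grace's theorem) for each such pair there is a unique sphere, called a Grace sphere, which is tangent to both spheres of the pair and passes through the three vertices of the face opposite to the vertex that is the centre of the homothety. There are 16 Grace spheres in total; a given tangent sphere $T$ belongs to four pairs, one for each vertex, so exactly four Grace spheres touch $T$ in this way, one through the vertices of each face.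
   Formalization: The fixed sphere is allowed to shrink to its centre (radius 0), but only when S and T are orthogonal; in that case all Grace spheres pass through the centre of S and in general no concentric sphere of positive radius is tangent to all of them. *)

(* Defs.v *)
From mathcomp Require Import all_boot all_order all_algebra.
From mathcomp Require Import boolp reals topology normedtype.

Set Implicit Arguments.
Unset Strict Implicit.
Unset Printing Implicit Defensive.

Import Order.TTheory GRing.Theory Num.Theory.
Import numFieldNormedType.Exports.

Local Open Scope ring_scope.

Section EuclideanSpace.
Context {R : realType}.
Implicit Types x y : 'rV[R]_3.

(* The norm [`|x|] of 'rV[R]_3 in the library is the sup norm, hence the
   explicit Euclidean distance. *)
Definition dot x y : R := \sum_(i < 3) x 0 i * y 0 i.
Definition edist x y : R := Num.sqrt (dot (x - y) (x - y)).

End EuclideanSpace.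

(* Point spheres (radius 0) are admitted because of the limiting case in which
   the fixed sphere shrinks to its centre.  A sphere through the vertices of a
   triangle, or tangent to the four face planes of a tetrahedron, has positive
   radius anyway. *)
Record sphere (R : realType) := Sphere {
  sph_center : 'rV[R]_3;
  sph_radius : R;
  sph_radius_ge0 : 0 <= sph_radius }.

Section Spheres.
Context {R : realType}.
Implicit Types (x : 'rV[R]_3) (S T G : sphere R).

Definition on_sphere S x : Prop := edist x (sph_center S) = sph_radius S.

(* External or internal tangency; a sphere counts as internally tangent to
   itself. *)
Definition tangent S T : Prop :=
  edist (sph_center S) (sph_center T) = sph_radius S + sph_radius T \/
  edist (sph_center S) (sph_center T) = `|sph_radius S - sph_radius T|.

Definition concentric S T : Prop := sph_center S = sph_center T.

(* Two intersecting spheres meet at right angles iff the radii to a common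
   point are perpendicular, i.e. by Pythagoras iff the equation below holds. *)
Definition orthogonal_spheres S T : Prop :=
  edist (sph_center S) (sph_center T) ^+ 2 =
  sph_radius S ^+ 2 + sph_radius T ^+ 2.

(* The plane P has with T a common point at which the radius of T is
   perpendicular to P. *)
Definition plane_tangent (P : 'rV[R]_3 -> Prop) T : Prop :=
  exists x, [/\ P x, on_sphere T x &
    forall y, P y -> dot (y - x) (x - sph_center T) = 0].

(* T' is the image of T under a homothety (of positive or negative ratio)
   with centre x. *)
Definition homothetic_at x T T' : Prop :=
  exists k : R, [/\ k != 0, sph_center T' - x = k *: (sph_center T - x) &
    sph_radius T' = `|k| * sph_radius T].

End Spheres.

Section Tetrahedra.
Context {R : realType}.
Implicit Types (V : 'I_4 -> 'rV[R]_3) (x : 'rV[R]_3) (v : 'I_4).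
Implicit Types (S T G : sphere R).

Definition tetrahedron V : Prop :=
  forall a : 'I_4 -> R, \sum_i a i = 0 -> \sum_i a i *: V i = 0 ->
  forall i, a i = 0.

Definition barycentric V x (a : 'I_4 -> R) : Prop :=
  \sum_i a i = 1 /\ \sum_i a i *: V i = x.

(* Plane of the face opposite to the vertex V v. *)
Definition face_plane V v x : Prop := exists2 a, barycentric V x a & a v = 0.

(* The plane of the face opposite to V v separates x from V v. *)
Definition separates V v x : Prop := exists2 a, barycentric V x a & a v < 0.

Definition circumscribed S V : Prop := forall v, on_sphere S (V v).

Definition tangent_sphere V T : Prop :=
  0 < sph_radius T /\ forall v, plane_tangent (face_plane V v) T.

(* The kind of a tangent sphere is read off from the number of faces whose
   plane separates its centre from the opposite vertex: none for the inscribed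
   sphere, one for the exscribed spheres, two for the doubly-exscribed ones. *)
Definition separating_faces V x : nat := #|[pred v | `[< separates V v x >]]|.

Definition inscribed V T : Prop :=
  tangent_sphere V T /\ separating_faces V (sph_center T) = 0%N.
Definition exscribed V T : Prop :=
  tangent_sphere V T /\ separating_faces V (sph_center T) = 1%N.
Definition doubly_exscribed V T : Prop :=
  tangent_sphere V T /\ separating_faces V (sph_center T) = 2%N.

Definition first_group V T : Prop := inscribed V T \/ doubly_exscribed V T.
Definition second_group V T : Prop := exscribed V T.

Definition grace_pair V v T T' : Prop :=
  (first_group V T /\ second_group V T' \/
   second_group V T /\ first_group V T') /\
  homothetic_at (V v) T T'.

(* G is the Grace sphere of the pair T, T', which is homothetic with respect
   to V v. *)
Definition grace_sphere V v T T' G : Prop :=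
  [/\ grace_pair V v T T', tangent G T, tangent G T' &
      forall w, w != v -> on_sphere G (V w)].

(* A moving tetrahedron; the parameter of V is time. *)
Definition moving_tetrahedron (V : R -> 'I_4 -> 'rV[R]_3) : Prop :=
  (forall v, continuous (fun t => V t v)) /\ forall t, tetrahedron (V t).

End Tetrahedra.

(* Main.v *)
(** If [P] is the point where [T] (centre [I], radius [r]) touches a face plane
    and [n := P - I], then the centre [K] of a sphere [G] through the vertices
    of the face satisfies [K = O + k n], where [O] is the centre of [S].  Let
    [R] and [g] be the radii of [S] and [G] and put [d := |O - I|].  Subtracting
    [|B - O|^2 = R^2] from [|B - K|^2 = g^2] at a vertex [B] of the face turns
    tangency of [G] and [T] into [d^2 - R^2 - r^2 + 2 k r^2 = +- 2 g r].  As
    [|K - O| = |k| r], this says that [G] touches the sphere with centre [O]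
    and radius [|d^2 - R^2 - r^2| / 2r].  Neither the motion nor the second
    sphere of the Grace pair matters. *)

From Pilot Require Import Defs.
From mathcomp Require Import all_boot all_order all_algebra.
From mathcomp Require Import boolp reals topology normedtype.
From mathcomp Require Import ring lra.

Set Implicit Arguments.
Unset Strict Implicit.
Unset Printing Implicit Defensive.

Import Order.TTheory GRing.Theory Num.Theory.
Import numFieldNormedType.Exports.

Local Open Scope ring_scope.

(* [topology] also exports an [edist], which hides the Euclidean one. *)
Local Notation edist := Pilot.Defs.edist.

Section Dot.
Context {R : realType}.
Implicit Types x y z : 'rV[R]_3.

Lemma dotC x y : dot x y = dot y x.
Proof. by apply: eq_bigr => i _; rewrite mulrC. Qed.

Lemma dotDl x y z : dot (x + y) z = dot x z + dot y z.
Proof. by rewrite -big_split; apply: eq_bigr => i _; rewrite mxE mulrDl. Qed.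

Lemma dotZl (k : R) x y : dot (k *: x) y = k * dot x y.
Proof. by rewrite mulr_sumr; apply: eq_bigr => i _; rewrite mxE mulrA. Qed.

Lemma dotNl x y : dot (- x) y = - dot x y.
Proof. by rewrite -scaleN1r dotZl mulN1r. Qed.

Lemma dotDr x y z : dot x (y + z) = dot x y + dot x z.
Proof. by rewrite dotC dotDl !(dotC x). Qed.

Lemma dotZr (k : R) x y : dot x (k *: y) = k * dot x y.
Proof. by rewrite dotC dotZl (dotC x). Qed.

Lemma dotNr x y : dot x (- y) = - dot x y.
Proof. by rewrite dotC dotNl (dotC x). Qed.

Definition dot_linear := (dotDl, dotDr, dotNl, dotNr, dotZl, dotZr).

Lemma dot_ge0 x : 0 <= dot x x.
Proof. by apply: sumr_ge0 => i _; rewrite -expr2 sqr_ge0. Qed.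

Lemma edist_sqr x y : edist x y ^+ 2 = dot (x - y) (x - y).
Proof. by rewrite sqr_sqrtr ?dot_ge0. Qed.

End Dot.

Section FaceNormals.
Context {R : realType}.
Variables (V : 'I_4 -> 'rV[R]_3) (V_tetra : tetrahedron V).

(** Affine independence makes the 4x4 matrix [A] with rows [(1, V i)] invertible, and [c] extends to
    a column in its kernel. *)
Lemma orthogonal_edges_eq0 (c : 'rV[R]_3) w :
  (forall i, dot (V i - V w) c = 0) -> c = 0.
Proof.
move=> c_orth.
pose A : 'M[R]_(4, 1 + 3) := row_mx (const_mx 1) (\matrix_i V i).
have /row_freeP[B AB1] : row_free A.
  apply: inj_row_free => a /eqP.
  rewrite mul_mx_row row_mx_eq0 => /andP[/eqP a_sum /eqP a_comb].
  apply/rowP => i; rewrite mxE; apply: (V_tetra (a := fun i => a 0 i)).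
    move/matrixP/(_ 0 0): a_sum; rewrite !mxE => {2}<-.
    by apply: eq_bigr => j _; rewrite mxE mulr1.
  rewrite -{}[RHS]a_comb mulmx_sum_row.
  by apply: eq_bigr => j _; rewrite rowK.
(* The top entry is chosen so that row [i] of [A *m f] is [dot (V i - V w) c]. *)
pose f : 'cV[R]_(1 + 3) := col_mx (- dot (V w) c)%:M c^T.
have Af0 : A *m f = 0.
  rewrite mul_row_col; apply/colP => i.
  rewrite mxE [X in X + _]mxE big_ord1 !mxE eqxx mulr1n mul1r.
  rewrite -[RHS](c_orth i) dotDl dotNl addrC; congr (_ + _).
  by apply: eq_bigr => j _; rewrite !mxE.
have BA1 : B *m A = 1%:M by apply: mulmx1C.
have f0 : f = 0 by rewrite -[f]mul1mx -BA1 -mulmxA Af0 mulmx0.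
move/eqP: f0; rewrite col_mx_eq0 => /andP[_ /eqP cT0].
by rewrite -[c]trmxK cT0 trmx0.
Qed.

(** The vector [alpha *: m - beta *: n] is normal to the face and, by the choice of coefficients,
    orthogonal to the edge from [V w] to [V v] as well, so it vanishes. *)
Lemma face_normal_unique v (m n : 'rV[R]_3) :
    n != 0 ->
    (forall i j, i != v -> j != v -> dot (V i - V j) n = 0) ->
    (forall i j, i != v -> j != v -> dot (V i - V j) m = 0) ->
  exists k, m = k *: n.
Proof.
move=> n_neq0 n_orth m_orth; pose w := lift v ord0.
have wv : w != v by rewrite eq_sym neq_lift.
pose alpha := dot (V v - V w) n; pose beta := dot (V v - V w) m.
have alpha_neq0 : alpha != 0.
  apply: contra_neq n_neq0 => alpha0; apply: (@orthogonal_edges_eq0 _ w) => i.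
  by have [->|iv] := eqVneq i v; [exact: alpha0|exact: n_orth].
exists (beta / alpha).
have /subr0_eq : alpha *: m - beta *: n = 0.
  apply: (@orthogonal_edges_eq0 _ w) => i; rewrite dotDr dotNr !dotZr.
  have [->|iv] := eqVneq i v; first by rewrite -/alpha -/beta mulrC subrr.
  by rewrite n_orth // m_orth // !mulr0 subrr.
by move/(congr1 (fun x => alpha^-1 *: x)); rewrite !scalerA mulVf // scale1r mulrC.
Qed.

End FaceNormals.

Lemma vertex_on_face (R : realType) (V : 'I_4 -> 'rV[R]_3) v w :
  w != v -> face_plane V v (V w).
Proof.
move=> wv; exists (fun i => (i == w)%:R); last by rewrite eq_sym (negbTE wv).
split; rewrite (bigD1 w) //= eqxx big1 ?addr0 ?scale1r // => i /negbTE -> //.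
by rewrite scale0r.
Qed.

(** Applied to the centres of [G] and [S], this makes the line joining them normal to the face. *)
Lemma equidistant_orthogonal (R : realType) (x y p q : 'rV[R]_3) :
  edist x p = edist y p -> edist x q = edist y q -> dot (x - y) (p - q) = 0.
Proof.
move=> /(congr1 (fun z => z ^+ 2)) + /(congr1 (fun z => z ^+ 2)).
rewrite !edist_sqr !dot_linear (dotC p x) (dotC p y) (dotC q x) (dotC q y).
by move=> ? ?; lra.
Qed.

(** For signed radii [a] and [b] at distance [|a - b|], opposite signs mean external tangency and
    equal signs internal tangency. *)
Lemma norm_diff_cases (R : realDomainType) (a b : R) :
  `|a - b| = `|a| + `|b| \/ `|a - b| = `| `|a| - `|b| |.
Proof.
have [a0|/ltW a0] := ger0P a; have [b0|/ltW b0] := ger0P b.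
- by right.
- by left; rewrite ger0_norm // subr_ge0 (le_trans b0).
- by left; rewrite ler0_norm ?subr_le0 ?(le_trans a0) // opprB addrC.
- by right; rewrite -opprD normrN.
Qed.

(** If [S] and [T] meet at angle [theta], this is the radius of [S] times [|cos theta|], by the law
    of cosines. *)
Definition envelope_radius (R : realType) (S T : sphere R) : R :=
  `|edist (sph_center S) (sph_center T) ^+ 2
    - sph_radius S ^+ 2 - sph_radius T ^+ 2| / (2 * sph_radius T).

Lemma envelope_radius_ge0 (R : realType) (S T : sphere R) :
  0 <= envelope_radius S T.
Proof. by rewrite divr_ge0 // mulr_ge0 ?sph_radius_ge0. Qed.

Lemma face_sphere_tangent (R : realType) (S T G Q : sphere R)
    (V : 'I_4 -> 'rV[R]_3) v :
    tetrahedron V -> circumscribed S V -> 0 < sph_radius T ->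
    plane_tangent (face_plane V v) T ->
    tangent G T -> (forall w, w != v -> on_sphere G (V w)) ->
    concentric Q S -> sph_radius Q = envelope_radius S T ->
  tangent G Q.
Proof.
move=> V_tetra S_circ r_gt0 [P [_ P_on P_orth]] GT G_on QS Qr.
pose n := P - sph_center T; pose r := sph_radius T; pose g := sph_radius G.
have nn : dot n n = r ^+ 2 by rewrite -edist_sqr P_on.
have n_neq0 : n != 0.
  apply: contraTneq r_gt0 => n0; rewrite -/r.
  have : r ^+ 2 = 0 by rewrite -nn n0 -(scale0r 0) dotZl mul0r.
  by move/eqP; rewrite sqrf_eq0 => /eqP ->; rewrite ltxx.
have face_orth i : i != v -> dot (V i - P) n = 0.
  by move=> iv; apply: P_orth; apply: vertex_on_face.
have [k Kk] : exists k, sph_center G - sph_center S = k *: n.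
  apply: (face_normal_unique V_tetra (v := v) n_neq0) => i j iv jv.
    rewrite -[V i](subrK P) -addrA dotDl face_orth // add0r.
    by rewrite -opprB dotNl face_orth // oppr0.
  by apply: equidistant_orthogonal; rewrite ?G_on // !S_circ.
have KO : edist (sph_center G) (sph_center S) = `|k * r|.
  by rewrite /edist Kk dotZl dotZr mulrA -expr2 nn -exprMn sqrtr_sqr.
pose delta := edist (sph_center S) (sph_center T) ^+ 2
              - sph_radius S ^+ 2 - r ^+ 2.
(* [e] is the signed radius of [G]: positive for external, negative for internal tangency with
   [T]. *)
have [e [e2 eq_e]] : exists e, `|e| = g /\ delta + 2 * k * r ^+ 2 = 2 * e * r.
  have KT : edist (sph_center G) (sph_center T) ^+ 2 =
            delta + 2 * k * r ^+ 2 + g ^+ 2 + r ^+ 2.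
    pose w := lift v ord0.
    have wv : w != v by rewrite eq_sym neq_lift.
    have := congr1 (fun z => z ^+ 2) (G_on w wv).
    have := congr1 (fun z => z ^+ 2) (S_circ w).
    (* With the factor [k], the claim is a linear combination of these three equations. *)
    have := congr1 (fun z => k * z) (face_orth w wv).
    have -> : sph_center G = sph_center S + k *: n by rewrite -Kk addrC subrK.
    have EP : P = sph_center T + n by rewrite addrC subrK.
    rewrite /delta !edist_sqr EP; clearbody n.
    set o := sph_center S; set c := sph_center T; set B := V w.
    rewrite -/g !dot_linear nn.
    rewrite (dotC n B) (dotC n c) (dotC n o) (dotC o B) (dotC c o).
    by lra.
  have g0 : 0 <= g := sph_radius_ge0 G.
  case: GT => GT; move: KT; rewrite GT -/g -/r.
    by move=> ?; exists g; rewrite ger0_norm //; split=> //; lra.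
  rewrite real_normK ?num_real // => ?.
  by exists (- g); rewrite normrN ger0_norm //; split=> //; lra.
have Qe : sph_radius Q = `|e - k * r|.
  rewrite Qr /envelope_radius -/r -/delta.
  have -> : delta = (e - k * r) * (2 * r) by lra.
  have r2_gt0 : 0 < 2 * r by rewrite mulr_gt0.
  by rewrite normrM (gtr0_norm r2_gt0) mulfK // gt_eqF.
(* The signed radii [e] and [e - k * r] differ by [k * r], which is up to sign the distance of the
   centres. *)
rewrite /tangent QS KO Qe -/g -e2.
by have := norm_diff_cases e (e - k * r); rewrite subKr.
Qed.

Theorem mainTheorem5 (R : realType) (S T : sphere R) :
  exists Q : sphere R,
    [/\ concentric Q S,
        sph_radius Q = 0 -> orthogonal_spheres S T
      & forall V : R -> 'I_4 -> 'rV[R]_3,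
          moving_tetrahedron V ->
          (forall t, circumscribed S (V t) /\ tangent_sphere (V t) T) ->
          forall t v T' G, grace_sphere (V t) v T T' G -> tangent G Q].
Proof.
have [r0|r_neq0] := eqVneq (sph_radius T) 0.
  (* The envelope radius is then the junk value x / 0 = 0, so another sphere
     is needed; the condition on it is void. *)
  exists (Sphere (sph_center S) ler01); split=> //= [/eqP|V _ VST t].
    by rewrite oner_eq0.
  by have [_ []] := VST t; rewrite r0 ltxx.
exists (Sphere (sph_center S) (envelope_radius_ge0 S T)); split=> //=.
  (* The radius vanishes only with its numerator, whose vanishing is the orthogonality of [S] and
     [T]. *)
  move/eqP; rewrite mulf_eq0 invr_eq0 mulf_eq0 pnatr_eq0 (negbTE r_neq0) !orbF.
  by rewrite normr_eq0 -addrA -opprD subr_eq0 => /eqP.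
move=> V [_ V_tetra] VST t v T' G [_ GT _ G_on].
have [S_circ [r_gt0 T_tan]] := VST t.
exact: (face_sphere_tangent (V_tetra t) S_circ r_gt0 (T_tan v) GT G_on).
Qed.
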